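(* For every holomorphic function $f(z)=\sum_{n=0}^\infty a_nz^n$ on $\mathbb{D}$ such that $|f(z)|\le 1$ for every $z\in\mathbb{D}$, and every $0\le r\le 1/3$, we have $$\sum_{n=0}^\infty|a_n|r^n+\Big(1-|a_0|-r\,\frac{1-|a_0|^2}{1-|a_0|r}\Big)\le 1\qquad\text{if } r\le|a_0|\le 1,$$ and $$\sum_{n=0}^\infty|a_n|r^n+\Big(1-|a_0|-r\,\frac{\sqrt{1-|a_0|^2}}{\sqrt{1-r^2}}\Big)\le 1\qquad\text{if } 0\le|a_0|<r.$$ Moreover, the inequalities are optimal in the sense that, for each $0\le r\le 1/3$, there is no $\lambda_r>1$ such that $\sum_{n=0}^\infty|a_n|r^n+\lambda_r\,\psi(f,r)\le 1$ for every $f(z)=\sum_{n=0}^\infty a_nz^n\in\mathcal{B}$.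
   Context: $\mathbb{D}$ is the open unit disc of $\mathbb{C}$ and $\mathcal{B}$ is the class of all holomorphic functions $f\colon\mathbb{D}\to\mathbb{C}$, $f(z)=\sum_{n=0}^\infty a_n z^n$, with $|f(z)|\le 1$ for every $z\in\mathbb{D}$. The function $\psi\colon\mathcal{B}\times[0,1/3]\to\mathbb{R}$ is defined by $\psi(f,r)=\Psi(|f(0)|,r)$, where $\Psi\colon[0,1]\times[0,1/3]\to\mathbb{R}$ is $$\Psi(a,r)=\begin{cases}1-a-r\,\dfrac{1-a^2}{1-ar}, & \text{if } r\le a\le 1,\\[2mm] 1-a-r\,\dfrac{\sqrt{1-a^2}}{\sqrt{1-r^2}}, & \text{if } 0\le a\le r\end{cases}$$ (the two expressions agree at $a=r$). *)

(* Defs.v *)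
From Stdlib Require Import Reals.
From Coquelicot Require Import Coquelicot.
Open Scope R_scope.

(* Functions on the disc are total functions C -> C; only their values at
   points with Cmod z < 1 matter. *)
Definition holomorphic_on_disc (f : C -> C) : Prop :=
  forall z : C, Cmod z < 1 ->
    @ex_derive C_AbsRing C_NormedModule f z.

Definition class_B (f : C -> C) : Prop :=
  holomorphic_on_disc f /\ forall z : C, Cmod z < 1 -> Cmod (f z) <= 1.

(* f(z) = sum_n a_n z^n on the unit disc; this determines a, and a 0 = f 0. *)
Definition power_series_on_disc (f : C -> C) (a : nat -> C) : Prop :=
  forall z : C, Cmod z < 1 -> @is_pseries C_AbsRing C_NormedModule a z (f z).

Definition Psi (a r : R) : R :=
  if Rle_dec r a
  then 1 - a - r * ((1 - a ^ 2) / (1 - a * r))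
  else 1 - a - r * (sqrt (1 - a ^ 2) / sqrt (1 - r ^ 2)).

Definition psi (f : C -> C) (r : R) : R := Psi (Cmod (f (RtoC 0))) r.

(* Main.v *)
Require Import Defs.
From Stdlib Require Import Reals Lra Lia.
From Coquelicot Require Import Coquelicot.
Open Scope R_scope.

(** Multiplication by [f] is a contraction of the Hardy space.  Testing it on [1 + c z^n]
    with [c] proportional to [conj (a 0) * a n] gives, for [q = |a_0|^2] and
    [S_n = |a_1|^2 + ... + |a_n|^2], the recursion [S_n <= (1-q)^2 + q S_(n-1)], so the sums
    [S_n] are dominated by those of the disc automorphism with the same [|a_0|].
    Summation by parts turns this into
    [sum_(k>=1) |a_k|^2 rho^k <= rho (1-q)^2 / (1 - q rho)] for [0 <= rho <= 1], and the
    Cauchy-Schwarz inequality concludes, with [rho = r / |a_0|] if [r <= |a_0|] and [rho = 1]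
    otherwise.  The contraction property needs only the Parseval identity at roots of unity,
    applied to partial sums on circles of radius [R < 1]. *)

(* [ring] does not see through the carrier projections of Coquelicot's structures. *)
Ltac ring_in T := match goal with |- ?x = ?y => change (@eq T x y) end; ring.

Lemma pow_n_Cpow (z : C) (n : nat) : @pow_n C_AbsRing z n = (z ^ n)%C.
Proof. reflexivity. Qed.

(** * Roots of unity and the discrete Parseval identity *)

(** The witness is [exp (2 pi i / N)]. The real part of its [k]-th power is
    [1 - 2 sin^2 (k pi / N)], which is below 1 because [0 < k pi / N < pi]. *)
Lemma primitive_root_of_unity (N : nat) : (0 < N)%nat ->
  exists w : C, Cmod w = 1 /\ (w ^ N)%C = 1 /\
    forall k : nat, (0 < k < N)%nat -> (w ^ k)%C <> 1.
Proof.
  intros HN.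
  set (t := 2 * PI / INR N).
  assert (HNpos : 0 < INR N) by now apply lt_0_INR.
  assert (Hpow : forall k : nat,
    (((cos t, sin t) : C) ^ k)%C = (cos (INR k * t), sin (INR k * t))).
  { induction k as [|k IH].
    - simpl; rewrite Rmult_0_l, cos_0, sin_0; reflexivity.
    - rewrite Cpow_S, IH, S_INR.
      replace ((INR k + 1) * t) with (t + INR k * t) by ring.
      rewrite cos_plus, sin_plus; unfold Cmult; simpl; f_equal; ring. }
  exists (cos t, sin t); repeat split.
  - unfold Cmod; simpl.
    replace (cos t * (cos t * 1) + sin t * (sin t * 1)) with (Rsqr (sin t) + Rsqr (cos t))
      by (unfold Rsqr; ring).
    now rewrite sin2_cos2, sqrt_1.
  - rewrite Hpow.
    replace (INR N * t) with (2 * PI) by (unfold t; field; lra).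
    now rewrite cos_2PI, sin_2PI.
  - intros k Hk Heq.
    rewrite Hpow in Heq; apply (f_equal fst) in Heq; simpl in Heq.
    replace (INR k * t) with (2 * (INR k * PI / INR N)) in Heq
      by (unfold t; field; lra).
    rewrite cos_2a_sin in Heq.
    assert (Hs : 0 < sin (INR k * PI / INR N)).
    { pose proof PI_RGT_0 as HPI.
      assert (0 < INR k) by (apply lt_0_INR; lia).
      assert (INR k < INR N) by (apply lt_INR; lia).
      apply sin_gt_0.
      - apply Rdiv_lt_0_compat; [nra | lra].
      - apply Rlt_div_l; nra. }
    nra.
Qed.

Lemma sum_n_Cconj (u : nat -> C) (n : nat) :
  Cconj (sum_n u n) = sum_n (fun k => Cconj (u k)) n.
Proof.
  induction n as [|n IH]; [now rewrite !sum_O|].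
  rewrite !sum_Sn, <- IH; apply Cplus_conj.
Qed.

Lemma sum_n_Re (u : nat -> C) (n : nat) :
  Re (sum_n u n) = sum_n (fun k => Re (u k)) n.
Proof.
  induction n as [|n IH]; [now rewrite !sum_O|].
  rewrite !sum_Sn, <- IH; reflexivity.
Qed.

Lemma sum_n_root_of_unity (w : C) (L : nat) :
  (w ^ S L)%C = 1 -> w <> 1 -> sum_n (fun j => (w ^ j)%C) L = RtoC 0.
Proof.
  intros HL Hw.
  assert (Hgeom : forall n, ((w - 1) * sum_n (fun j => (w ^ j)%C) n)%C = (w ^ S n - 1)%C).
  { induction n as [|n IH].
    - rewrite sum_O; simpl; ring.
    - rewrite sum_Sn; change (@plus C_AbelianMonoid) with Cplus.
      rewrite Cmult_plus_distr_l, IH, !Cpow_S; ring. }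
  specialize (Hgeom L); rewrite HL in Hgeom.
  destruct (Ceq_dec (sum_n (fun j => (w ^ j)%C) L) 0) as [E|E]; [exact E|].
  exfalso; apply Hw.
  replace w with ((w - 1) * sum_n (fun j => (w ^ j)%C) L
                   * / sum_n (fun j => (w ^ j)%C) L + 1)%C.
  - rewrite Hgeom; ring.
  - field; exact E.
Qed.

Lemma Cmod2_plus (x y : C) :
  Cmod (x + y) ^ 2 = Cmod x ^ 2 + Cmod y ^ 2 + 2 * Re (x * Cconj y).
Proof.
  rewrite !Cmod2_alt; destruct x, y; simpl; ring.
Qed.

(** Induction on [M]: the new term is orthogonal to each earlier one, since their product sums a
    power of [w] with exponent between 1 and [L]. The bound [M <= L] keeps these exponents below the
    order of [w]. *)
Lemma discrete_parseval (w : C) (L M : nat) (p : nat -> C) :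
  Cmod w = 1 -> (w ^ S L)%C = 1 ->
  (forall k, (0 < k < S L)%nat -> (w ^ k)%C <> 1) -> (M <= L)%nat ->
  sum_n (fun j => Cmod (sum_n (fun k => (p k * (w ^ j) ^ k)%C) M) ^ 2) L
  = INR (S L) * sum_n (fun k => Cmod (p k) ^ 2) M.
Proof.
  intros Hw HL Hk.
  assert (Hunit : forall k, (Cconj (w ^ k) * w ^ k)%C = 1).
  { intros k; rewrite Cmult_comm, <- Cmod2_conj, Cmod_pow, Hw, !pow1; reflexivity. }
  assert (Hmod : forall j k, Cmod ((w ^ j) ^ k)%C = 1).
  { intros j k; rewrite !Cmod_pow, Hw, !pow1; reflexivity. }
  induction M as [|M IH]; intros HM.
  - rewrite (sum_n_ext _ (fun _ => Cmod (p 0%nat) ^ 2)).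
    + now rewrite sum_n_const, sum_O.
    + intros j; rewrite sum_O; simpl Cpow; now rewrite Cmult_1_r.
  - rewrite (sum_n_ext _ (fun j =>
      plus (plus (Cmod (sum_n (fun k => (p k * (w ^ j) ^ k)%C) M) ^ 2) (Cmod (p (S M)) ^ 2))
           (@mult R_Ring 2 (Re (sum_n (fun k => (p k * (w ^ j) ^ k)%C) M
                     * Cconj (p (S M) * (w ^ j) ^ S M))%C)))).
    2:{ intros j; rewrite sum_Sn; change (@plus C_AbelianMonoid) with Cplus.
        rewrite Cmod2_plus, (Cmod_mult (p (S M))), Hmod, Rmult_1_r; reflexivity. }
    rewrite !sum_n_plus, IH by lia.
    rewrite sum_n_const, (@sum_n_mult_l R_Ring), <- sum_n_Re, (sum_Sn (fun k => Cmod (p k) ^ 2)).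
    change (@plus R_AbelianMonoid) with Rplus; change (@mult R_Ring) with Rmult.
    match goal with |- context [Re ?x] => cut (x = RtoC 0) end.
    { intros ->; simpl Re; ring_in R. }
    rewrite (sum_n_ext _ (fun j => sum_n (fun k =>
       mult (p k * Cconj (p (S M)))%C (Cconj ((w ^ (S M - k)) ^ j)%C)) M)).
    2:{ intros j; rewrite <- (@sum_n_mult_r C_Ring).
        apply sum_n_ext_loc; intros k Hk'.
        change (@mult C_Ring) with Cmult.
        rewrite <- !Cpow_mult_r, Cmult_conj.
        (* Splitting off [j * k] lets the factor [w ^ (j * k)] cancel against its conjugate. *)
        replace (j * S M)%nat with ((S M - k) * j + j * k)%nat by nia.
        rewrite Cpow_add_r, Cmult_conj.
        match goal with |- ?x = ?y => change (@eq C x y) end.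
        transitivity (p k * Cconj (p (S M)) * Cconj (w ^ ((S M - k) * j)) *
                      (Cconj (w ^ (j * k)) * w ^ (j * k)))%C; [ring|].
        rewrite Hunit; ring. }
    rewrite sum_n_switch.
    rewrite (sum_n_ext_loc _ (fun _ => zero)).
    { apply (@sum_n_m_const_zero C_AbelianMonoid). }
    intros k Hk'.
 rewrite (@sum_n_mult_l C_Ring), <- sum_n_Cconj, sum_n_root_of_unity.
    + replace (Cconj 0) with (RtoC 0) by (unfold Cconj; simpl; now rewrite Ropp_0).
      apply Cmult_0_r.
    + rewrite <- Cpow_mult_r, Nat.mul_comm, Cpow_mult_r, HL; apply Cpow_1_l.
    + apply Hk; lia.
Qed.

(** * Uniform convergence of power series on circles *)

(** Convergence at [R'] forces the terms there to have modulus below 1 from some index [N] on; the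
    tail at [R] is then dominated by the geometric series of ratio [R / R']. *)
Lemma pseries_abs_summable (d : nat -> C) (R' R : R) (l : C) :
  0 <= R < R' -> @is_pseries C_AbsRing C_NormedModule d (RtoC R') l ->
  ex_series (fun k => Cmod (d k) * R ^ k).
Proof.
  intros HR Hl.
  destruct (Cauchy_ex_series (V := C_CompleteNormedModule) _
             (ex_intro _ l Hl) (mkposreal 1 Rlt_0_1)) as [N HN].
  apply (ex_series_incr_n _ N).
  apply (ex_series_le (V := R_CompleteNormedModule)) with (b := fun k => (R / R') ^ k).
  - intros k.
    specialize (HN (N + k)%nat (N + k)%nat ltac:(lia) ltac:(lia)); simpl in HN.
    rewrite sum_n_n in HN.
    change (Cmod (pow_n (K := C_AbsRing) (RtoC R') (N + k) * d (N + k)%nat)%C < 1) in HN.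
    rewrite pow_n_Cpow, Cmod_mult, Cmod_pow, Cmod_R, Rabs_pos_eq in HN by lra.
    assert (Hpow : 0 <= (R / R') ^ (N + k)).
    { apply pow_le, Rdiv_le_0_compat; lra. }
    change (Rabs (Cmod (d (N + k)%nat) * R ^ (N + k)) <= (R / R') ^ k).
    rewrite Rabs_pos_eq by (apply Rmult_le_pos; [apply Cmod_ge_0 | apply pow_le; lra]).
    replace R with (R' * (R / R')) at 1 by (field; lra).
    rewrite Rpow_mult_distr.
    apply Rle_trans with ((R / R') ^ (N + k)); [nra|].
    rewrite pow_add.
    assert (HN1 : (R / R') ^ N <= 1).
    { rewrite <- (pow1 N); apply pow_incr; split.
      - apply Rdiv_le_0_compat; lra.
      - apply Rle_div_l; lra. }
    assert (0 <= (R / R') ^ k) by (apply pow_le, Rdiv_le_0_compat; lra).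
    nra.
  - apply ex_series_geom; rewrite Rabs_pos_eq.
    + apply Rlt_div_l; lra.
    + apply Rdiv_le_0_compat; lra.
Qed.

(** [M0] comes from the absolutely convergent series at radius [R], so it does not depend on [z].
    Pointwise convergence enters only through an auxiliary index [M2], which disappears from the
    estimate. *)
Lemma pseries_uniform_on_circle (d : nat -> C) (g : C -> C) (R eps : R) :
  0 <= R < 1 -> power_series_on_disc g d -> 0 < eps ->
  exists M0 : nat, forall M, (M0 <= M)%nat -> forall z, Cmod z = R ->
    Cmod (sum_n (fun k => d k * z ^ k)%C M - g z) <= eps.
Proof.
  intros HR Hg Heps.
  assert (Hser : ex_series (fun k => Cmod (d k) * R ^ k)).
  (* Any radius strictly between [R] and 1 would serve; this is the midpoint. *)
  { eapply (pseries_abs_summable d ((1 + R) / 2) R); [lra|].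
    apply Hg; rewrite Cmod_R, Rabs_pos_eq; lra. }
  assert (Heps2 : 0 < eps / 2) by lra.
  destruct (Cauchy_ex_series (V := R_CompleteNormedModule) _ Hser
             (mkposreal _ Heps2)) as [M0 HM0].
  simpl in HM0.
  exists M0; intros M HM z Hz.
  assert (Hz1 : Cmod z < 1) by lra.
  pose proof (proj1 (filterlim_locally_ball_norm _ _) (Hg z Hz1) (mkposreal _ Heps2))
    as [M1 HM1].
  set (M2 := S (M + M1)).
  specialize (HM1 M2 ltac:(unfold M2; lia)).
  unfold ball_norm in HM1; simpl in HM1.
  rewrite (sum_n_ext _ (fun k => d k * z ^ k)%C) in HM1.
  2:{ intros k; rewrite pow_n_Cpow; apply Cmult_comm. }
  change (Cmod (sum_n (fun k => d k * z ^ k)%C M2 - g z) < eps / 2) in HM1.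
  assert (Htail : Cmod (sum_n (fun k => d k * z ^ k)%C M2 - sum_n (fun k => d k * z ^ k)%C M)
                  <= eps / 2).
  { change (norm (minus (sum_n (fun k => d k * z ^ k)%C M2)
              (sum_n (fun k => d k * z ^ k)%C M)) <= eps / 2).
    rewrite <- (@sum_n_m_sum_n C_AbelianGroup) by (unfold M2; lia).
    eapply Rle_trans; [apply (@norm_sum_n_m C_AbsRing C_NormedModule)|].
    rewrite (sum_n_m_ext _ (fun k => Cmod (d k) * R ^ k)).
    - eapply Rle_trans; [apply Rle_abs|].
      left; apply HM0; unfold M2; lia.
    - intros k; change (Cmod (d k * z ^ k)%C = Cmod (d k) * R ^ k).
      now rewrite Cmod_mult, Cmod_pow, Hz. }
  replace (sum_n (fun k => d k * z ^ k)%C M - g z)%C with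
    ((sum_n (fun k => d k * z ^ k)%C M2 - g z)
     - (sum_n (fun k => d k * z ^ k)%C M2 - sum_n (fun k => d k * z ^ k)%C M))%C.
  2:{ ring_in C. }
  unfold Cminus at 1.
  eapply Rle_trans; [apply Cmod_triangle|].
  rewrite Cmod_opp; lra.
Qed.

(** * Bessel inequality for functions dominated by [1 + c z^n] *)

Lemma sum_n_nonneg_le (u : nat -> R) (n m : nat) :
  (forall k, 0 <= u k) -> (n <= m)%nat -> sum_n u n <= sum_n u m.
Proof.
  intros Hu; induction 1 as [|m _ IH]; [lra|].
  rewrite sum_Sn; change (@plus R_AbelianMonoid) with Rplus; specialize (Hu (S m)); lra.
Qed.

(** Average the squared modulus of a partial sum over the [S M] roots of unity scaled to radius [R].
    Parseval evaluates the average exactly; on the dominating side the cross term of [|1 + c z^n|^2]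
    averages to zero. *)
Lemma bessel_on_circle (g : C -> C) (d : nat -> C) (c : C) (n : nat) (R : R) :
  0 < R < 1 -> (0 < n)%nat -> power_series_on_disc g d ->
  (forall z, Cmod z < 1 -> Cmod (g z) <= Cmod (1 + c * z ^ n)) ->
  sum_n (fun k => (Cmod (d k) * R ^ k) ^ 2) n <= 1 + Cmod c ^ 2.
Proof.
  intros HR Hn Hg Hle.
  pose proof (Cmod_ge_0 c) as Hc.
  apply Rle_plus_epsilon; intros e He.
  (* For [u <= 1 + |c|] and [eps <= 1], [(u + eps)^2 - u^2 = eps (2 u + eps) <= eps K]. *)
  set (K := 2 * (1 + Cmod c) + 1).
  assert (HK : 0 < K) by (unfold K; lra).
  set (eps := Rmin 1 (e / K)).
  assert (Heps : 0 < eps).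
  { apply Rmin_glb_lt; [lra | now apply Rdiv_lt_0_compat]. }
  assert (Heps1 : eps <= 1) by apply Rmin_l.
  assert (HepsK : eps * K <= e) by (apply Rle_div_r; [lra | apply Rmin_r]).
  destruct (pseries_uniform_on_circle d g R eps ltac:(lra) Hg Heps) as [M0 HM0].
  (* Adding [n] ensures [n < S M], hence [w ^ n <> 1], and makes the partial sum contain every index
     up to [n]. *)
  set (M := (M0 + n)%nat).
  specialize (HM0 M ltac:(unfold M; lia)).
  destruct (primitive_root_of_unity (S M) ltac:(lia)) as [w [Hw [HwM Hwk]]].
  assert (Hz : forall j, Cmod (R * w ^ j) = R).
  { intros j; rewrite Cmod_mult, Cmod_pow, Hw, pow1, Cmod_R, Rabs_pos_eq; lra. }
  pose proof (discrete_parseval w M M (fun k => d k * (R ^ k)%R)%C Hw HwM Hwk (le_n M)) as HP.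
  apply Rle_trans with (sum_n (fun k => Cmod (d k * (R ^ k)%R) ^ 2) M).
  { rewrite (sum_n_ext _ (fun k => Cmod (d k * (R ^ k)%R) ^ 2)).
    - apply sum_n_nonneg_le; [intros k; apply pow2_ge_0 | unfold M; lia].
    - intros k; rewrite Cmod_mult, Cmod_R, Rabs_pos_eq by (apply pow_le; lra); reflexivity. }
  assert (HN : 0 < INR (S M)) by (apply lt_0_INR; lia).
  apply Rmult_le_reg_l with (INR (S M)); [exact HN|].
  rewrite <- HP.
  apply Rle_trans with (sum_n (fun j =>
    plus (1 + Cmod c ^ 2 + e)
      (@mult R_Ring 2 (Re (@mult C_Ring (Cconj (c * (R ^ n)%R)) (Cconj ((w ^ n) ^ j)))%C))) M).
  - apply sum_n_m_le; intros j.
    rewrite (sum_n_ext _ (fun k => d k * (R * w ^ j) ^ k)%C).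
    2:{ intros k; rewrite Cpow_mult_l, RtoC_pow; symmetry; apply Cmult_assoc. }
    set (z := (R * w ^ j)%C).
    assert (Hcz : Cmod (c * z ^ n) <= Cmod c).
    { unfold z; rewrite Cmod_mult, Cmod_pow, Hz.
      assert (R ^ n <= 1) by (rewrite <- (pow1 n); apply pow_incr; lra).
      assert (0 <= R ^ n) by (apply pow_le; lra); nra. }
    set (A := sum_n (fun k => d k * z ^ k)%C M).
    assert (HA : Cmod A <= Cmod (1 + c * z ^ n) + eps).
    { replace A with (g z + (A - g z))%C
        by ring_in C.
      eapply Rle_trans; [apply Cmod_triangle|].
      apply Rplus_le_compat; [apply Hle | apply HM0]; unfold z; rewrite Hz; lra. }
    assert (Hu : Cmod (1 + c * z ^ n) <= 1 + Cmod c).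
    { eapply Rle_trans; [apply Cmod_triangle|]; rewrite Cmod_1; lra. }
    pose proof (Cmod_ge_0 A); pose proof (Cmod_ge_0 (1 + c * z ^ n)).
    apply Rle_trans with (Cmod (1 + c * z ^ n) ^ 2 + e).
    { apply Rle_trans with ((Cmod (1 + c * z ^ n) + eps) ^ 2); [apply pow_incr; lra|].
      unfold K in HepsK; nra. }
    rewrite Cmod2_plus, Cmod_1, Cmult_1_l.
    pose proof (Cmod_ge_0 (c * z ^ n)).
    replace (Cconj (c * z ^ n))%C with
      (@mult C_Ring (Cconj (c * (R ^ n)%R)) (Cconj ((w ^ n) ^ j)))%C.
    + change (@plus R_AbelianMonoid) with Rplus; change (@mult R_Ring) with Rmult; nra.
    + unfold z; change (@mult C_Ring) with Cmult.
      rewrite <- Cmult_conj, Cpow_mult_l, <- !Cpow_mult_r, RtoC_pow, (Nat.mul_comm n).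
      f_equal; ring.
  - rewrite sum_n_plus, sum_n_const, (@sum_n_mult_l R_Ring), <- sum_n_Re, (@sum_n_mult_l C_Ring),
      <- sum_n_Cconj, sum_n_root_of_unity.
    + change (@plus R_AbelianMonoid) with Rplus; change (@mult R_Ring) with Rmult.
      change (@mult C_Ring) with Cmult.
      replace (Cconj 0) with (RtoC 0) by (unfold Cconj; simpl; now rewrite Ropp_0).
      rewrite Cmult_0_r; simpl Re; lra.
    + rewrite <- Cpow_mult_r, Nat.mul_comm, Cpow_mult_r, HwM; apply Cpow_1_l.
    + apply Hwk; unfold M; lia.
Qed.

Lemma sum_n_le_loc (u v : nat -> R) (n : nat) :
  (forall k, (k <= n)%nat -> u k <= v k) -> sum_n u n <= sum_n v n.
Proof.
  induction n as [|n IH]; intros H.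
  - rewrite !sum_O; apply H; lia.
  - rewrite !sum_Sn; change (@plus R_AbelianMonoid) with Rplus.
    apply Rplus_le_compat; [apply IH; intros; apply H; lia | apply H; lia].
Qed.

Lemma bernoulli_sub (x : R) (n : nat) : 0 <= x <= 1 -> 1 - INR n * x <= (1 - x) ^ n.
Proof.
  intros Hx; induction n as [|n IH]; [simpl; lra|].
  rewrite S_INR; simpl pow.
  pose proof (pos_INR n).
  apply Rle_trans with ((1 - x) * (1 - INR n * x)).
  - assert (0 <= INR n * (x * x)) by (apply Rmult_le_pos; [lra | apply Rle_0_sqr]). lra.
  - apply Rmult_le_compat_l; lra.
Qed.

(** The limit [R -> 1] of the circle version, made quantitative: with [R = 1 - x], Bernoulli gives
    [R^(2n) >= 1 - 2 n x], and [x] is taken small enough that the loss [2 n x S] is at most [e]. *)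
Lemma bessel_disc (g : C -> C) (d : nat -> C) (c : C) (n : nat) :
  (0 < n)%nat -> power_series_on_disc g d ->
  (forall z, Cmod z < 1 -> Cmod (g z) <= Cmod (1 + c * z ^ n)) ->
  sum_n (fun k => Cmod (d k) ^ 2) n <= 1 + Cmod c ^ 2.
Proof.
  intros Hn Hg Hle.
  apply Rle_plus_epsilon; intros e He.
  set (S := sum_n (fun k => Cmod (d k) ^ 2) n).
  assert (HS : 0 <= S).
  { apply Rle_trans with (Cmod (d 0%nat) ^ 2); [apply pow2_ge_0|].
    rewrite <- (sum_O (fun k => Cmod (d k) ^ 2)).
    apply sum_n_nonneg_le; [intros k; apply pow2_ge_0 | lia]. }
  pose proof (pos_INR (n * 2)) as Hn2.
  set (K := INR (n * 2) * S + 1).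
  assert (HK : 0 < K) by (unfold K; nra).
  set (x := Rmin (1 / 2) (e / K)).
  assert (Hx0 : 0 < x).
  { apply Rmin_glb_lt; [lra | now apply Rdiv_lt_0_compat]. }
  assert (Hx1 : x <= 1 / 2) by apply Rmin_l.
  assert (HxK : x * K <= e) by (apply Rle_div_r; [lra | apply Rmin_r]).
  pose proof (bessel_on_circle g d c n (1 - x) ltac:(lra) Hn Hg Hle) as H.
  pose proof (bernoulli_sub x (n * 2) ltac:(lra)) as Hb.
  assert (Hlow : (1 - x) ^ (n * 2) * S <= sum_n (fun k => (Cmod (d k) * (1 - x) ^ k) ^ 2) n).
  { unfold S; rewrite <- (@sum_n_mult_l R_Ring).
    apply sum_n_le_loc; intros k Hk; change (@mult R_Ring) with Rmult.
    rewrite Rpow_mult_distr, pow_mult, Rmult_comm.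
    apply Rmult_le_compat_l; [apply pow2_ge_0|].
    apply pow_incr; split; [apply pow_le; lra|].
    replace n with (k + (n - k))%nat by lia.
    rewrite pow_add.
    assert (0 <= (1 - x) ^ k) by (apply pow_le; lra).
    pose proof (pow_incr (1 - x) 1 (n - k) ltac:(lra)) as Hp; rewrite pow1 in Hp.
    nra. }
  unfold K in HxK; nra.
Qed.

(** * Quadratic coefficient inequalities for the class B *)

(** The left side lists the coefficients of [f(z) (1 + c z^(m+1))] up to index [m+1]; the factor [c]
    first acts at that last index, where it meets [a 0]. *)
Lemma coefficient_inequality (f : C -> C) (a : nat -> C) (c : C) (m : nat) :
  class_B f -> power_series_on_disc f a ->
  sum_n (fun k => Cmod (a k) ^ 2) m + Cmod (a (S m) + c * a 0%nat) ^ 2 <= 1 + Cmod c ^ 2.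
Proof.
  intros [_ Hf] Ha.
  set (d := @PS_plus C_AbsRing C_NormedModule a
              (@PS_scal C_AbsRing C_NormedModule c
                (@PS_incr_n C_AbsRing C_NormedModule a (S m)))).
  assert (Hd : power_series_on_disc (fun z => f z * (1 + c * z ^ S m))%C d).
  { intros z Hz.
    replace (f z * (1 + c * z ^ S m))%C with
      (@plus C_NormedModule (f z)
        (@scal C_AbsRing C_NormedModule c
          (@scal C_AbsRing C_NormedModule (@pow_n C_AbsRing z (S m)) (f z)))).
    - apply is_pseries_plus; [now apply Ha|].
      apply is_pseries_scal; [apply Cmult_comm|].
      now apply is_pseries_incr_n, Ha.
    - rewrite pow_n_Cpow.
      change (f z + c * (z ^ S m * f z) = f z * (1 + c * z ^ S m))%C; ring. }
  assert (Hle : forall z, Cmod z < 1 ->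
            Cmod (f z * (1 + c * z ^ S m))%C <= Cmod (1 + c * z ^ S m)).
  { intros z Hz; rewrite Cmod_mult; specialize (Hf z Hz).
    pose proof (Cmod_ge_0 (1 + c * z ^ S m)); nra. }
  apply Rle_trans with (2 := bessel_disc _ d c (S m) ltac:(lia) Hd Hle).
  right; rewrite sum_Sn.
  change (@plus R_AbelianMonoid) with Rplus; f_equal.
  - apply sum_n_ext_loc; intros k Hk; unfold d, PS_plus, PS_scal.
    rewrite PS_incr_n_simplify.
    destruct (Compare_dec.le_lt_dec (S m) k) as [H|H]; [lia|].
    change (Cmod (a k) ^ 2 = Cmod (a k + c * 0) ^ 2).
    now rewrite Cmult_0_r, Cplus_0_r.
  - unfold d, PS_plus, PS_scal.
    rewrite PS_incr_n_simplify.
    destruct (Compare_dec.le_lt_dec (S m) (S m)) as [H|H]; [|lia].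
    rewrite Nat.sub_diag; reflexivity.
Qed.

Lemma Cmod_coef0_le (f : C -> C) (a : nat -> C) :
  class_B f -> power_series_on_disc f a -> Cmod (a 0%nat) <= 1.
Proof.
  intros Hf Ha.
  pose proof (coefficient_inequality f a 0 0 Hf Ha) as H.
  rewrite sum_O, Cmod_0 in H.
  pose proof (pow2_ge_0 (Cmod (a 1%nat + 0 * a 0%nat))).
  pose proof (Cmod_ge_0 (a 0%nat)); nra.
Qed.

(** With [q = |a_0|^2], the right side is [q + (1-q)^2 (1 + q + ... + q^(m-1))], the value attained
    by the disc automorphism. *)
Lemma sum_sq_coef_le (f : C -> C) (a : nat -> C) (m : nat) :
  class_B f -> power_series_on_disc f a ->
  sum_n (fun k => Cmod (a k) ^ 2) m
  <= 1 - (1 - Cmod (a 0%nat) ^ 2) * (Cmod (a 0%nat) ^ 2) ^ m.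
Proof.
  intros Hf Ha.
  pose proof (Cmod_coef0_le f a Hf Ha) as H0.
  pose proof (Cmod_ge_0 (a 0%nat)) as H0'.
  destruct (Rle_lt_or_eq_dec _ _ H0) as [Hlt|Heq].
  - induction m as [|m IH]; [rewrite sum_O; simpl; lra|].
    set (q := Cmod (a 0%nat) ^ 2) in *.
    assert (Hq : 0 <= q < 1) by (unfold q; simpl; nra).
    (* This [c] maximises [|a_(m+1) + c a_0|^2 - |c|^2]; the maximum is [|a_(m+1)|^2 / (1-q)]. *)
    pose proof (coefficient_inequality f a (Cconj (a 0%nat) * a (S m) / (1 - q)%R)%C m Hf Ha)
      as H.
    assert (Hq1 : RtoC (1 - q) <> 0) by (intros E; apply RtoC_inj in E; lra).
    replace (a (S m) + Cconj (a 0%nat) * a (S m) / (1 - q)%R * a 0%nat)%C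
      with (a (S m) / (1 - q)%R)%C in H.
    2:{ assert (E : RtoC q = (a 0%nat * Cconj (a 0%nat))%C) by apply Cmod2_conj.
        rewrite RtoC_minus in Hq1 |- *; rewrite E in Hq1 |- *; field; exact Hq1. }
    rewrite !Cmod_div, Cmod_mult, Cmod_conj, Cmod_R, Rabs_pos_eq in H by (assumption || lra).
    rewrite sum_Sn; change (@plus R_AbelianMonoid) with Rplus.
    set (P := sum_n (fun k => Cmod (a k) ^ 2) m) in *.
    set (x := Cmod (a (S m))) in *.
    assert (Hx : P + x ^ 2 / (1 - q) <= 1).
    { replace ((x / (1 - q)) ^ 2) with (x ^ 2 / (1 - q) + q * (x / (1 - q)) ^ 2) in H
        by (field; lra).
      replace ((Cmod (a 0%nat) * x / (1 - q)) ^ 2) with (q * (x / (1 - q)) ^ 2) in H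
        by (unfold q; field; fold q; lra).
      lra. }
    assert (Hx' : x ^ 2 <= (1 - P) * (1 - q)) by (apply Rle_div_l; lra).
    (* [P + x^2 <= (1-q) + q P], and the induction hypothesis bounds [P]. *)
    simpl pow at 2; nra.
  (* When [|a_0| = 1] the divisor [1 - q] vanishes, but the claimed bound is 1 and [c = 0] gives
     it. *)
  - pose proof (coefficient_inequality f a 0 m Hf Ha) as H.
    rewrite Heq; rewrite Cmod_0 in H.
    pose proof (pow2_ge_0 (Cmod (a (S m) + 0 * a 0%nat))).
    replace (1 - (1 - 1 ^ 2) * (1 ^ 2) ^ m) with 1 by ring; lra.
Qed.

(** * Majorization by a geometric sequence and weighted Cauchy-Schwarz *)

Lemma sum_n_shift (u : nat -> R) (m : nat) :
  sum_n u (S m) = u 0%nat + sum_n (fun k => u (S k)) m.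
Proof.
  induction m as [|m IH]; rewrite sum_Sn; [now rewrite !sum_O|].
  rewrite IH, (sum_Sn (fun k => u (S k))).
  change (@plus R_AbelianMonoid) with Rplus; apply Rplus_assoc.
Qed.

Lemma sum_n_geom (q : R) (m : nat) : (1 - q) * sum_n (fun k => q ^ k) m = 1 - q ^ S m.
Proof.
  induction m as [|m IH]; [rewrite sum_O; simpl; ring|].
  rewrite sum_Sn; change (@plus R_AbelianMonoid) with Rplus.
  rewrite Rmult_plus_distr_l, IH; simpl; ring.
Qed.

Lemma sum_n_geom_le (q : R) (m : nat) : 0 <= q < 1 -> sum_n (fun k => q ^ k) m <= / (1 - q).
Proof.
  intros Hq.
  apply Rmult_le_reg_l with (1 - q); [lra|].
  rewrite sum_n_geom, Rinv_r by lra.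
  pose proof (pow_le q (S m) ltac:(lra)); lra.
Qed.

(** The majorant [(1-q)^2 q^k] is the squared modulus of the coefficient of index [k+1] of the
    automorphism. *)
Lemma sum_sq_tail_le (f : C -> C) (a : nat -> C) (m : nat) :
  class_B f -> power_series_on_disc f a ->
  sum_n (fun k => Cmod (a (S k)) ^ 2) m
  <= sum_n (fun k => (1 - Cmod (a 0%nat) ^ 2) ^ 2 * (Cmod (a 0%nat) ^ 2) ^ k) m.
Proof.
  intros Hf Ha.
  pose proof (sum_sq_coef_le f a (S m) Hf Ha) as H.
  rewrite sum_n_shift in H.
  rewrite (@sum_n_mult_l R_Ring); change (@mult R_Ring) with Rmult.
  pose proof (sum_n_geom (Cmod (a 0%nat) ^ 2) m) as HG.
  set (G := sum_n _ m) in HG |- *; change (@sum_n (Ring.AbelianMonoid R_Ring) _ m) with G.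
  nra.
Qed.

(* Summation by parts: the differences [y - x] have nonnegative partial sums. *)
Lemma weighted_sum_le (x y w : nat -> R) :
  (forall m, sum_n x m <= sum_n y m) -> (forall k, 0 <= w (S k) <= w k) ->
  forall m, sum_n (fun k => w k * x k) m <= sum_n (fun k => w k * y k) m.
Proof.
  intros Hxy Hw m.
  (* Invariant for the induction: with [D_m] the difference of partial sums,
     [w_m D_m >= w_(m+1) D_m] absorbs the decrease of the weights. *)
  cut (w m * (sum_n y m - sum_n x m)
       <= sum_n (fun k => w k * y k) m - sum_n (fun k => w k * x k) m).
  { specialize (Hxy m); intros H.
    assert (0 <= w m) by (specialize (Hw m); lra); nra. }
  induction m as [|m IH]; [rewrite !sum_O; lra|].
  rewrite !sum_Sn; change (@plus R_AbelianMonoid) with Rplus.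
  specialize (Hxy m); specialize (Hw m); nra.
Qed.

(** Cauchy-Schwarz in AM-GM form: [r^2 = rho sigma] splits the weight into [rho], paired with the
    squares [x k ^ 2], and a geometric series in [sigma]. The scale [t] is left free so that each
    application can balance the two terms. *)
Lemma weighted_tail_le (x : nat -> R) (q rho sigma t r : R) (m : nat) :
  (forall k, 0 <= x k) ->
  (forall n, sum_n (fun k => x k ^ 2) n <= sum_n (fun k => (1 - q) ^ 2 * q ^ k) n) ->
  0 <= q < 1 -> 0 <= rho <= 1 -> 0 <= sigma < 1 -> r ^ 2 = rho * sigma -> 0 < t ->
  sum_n (fun k => x k * r ^ S k) m
  <= (t * rho * (1 - q) ^ 2 / (1 - q * rho) + sigma / (1 - sigma) / t) / 2.
Proof.
  intros Hx Hmaj Hq Hrho Hsigma Hr Ht.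
  apply Rle_trans with (sum_n (fun k =>
    @plus R_AbelianMonoid (@mult R_Ring (t * rho / 2) (rho ^ k * x k ^ 2))
         (@mult R_Ring (sigma / t / 2) (sigma ^ k))) m).
  - apply sum_n_m_le; intros k.
    change (@plus R_AbelianMonoid) with Rplus; change (@mult R_Ring) with Rmult.
    (* AM-GM: [2 x r^(k+1) <= t x^2 rho^(k+1) + sigma^(k+1) / t] *)
    assert (Hpow : (r ^ S k) ^ 2 = rho ^ S k * sigma ^ S k).
    { rewrite <- pow_mult, Nat.mul_comm, pow_mult, Hr; apply Rpow_mult_distr. }
    assert (Hsq : 0 <= t * (x k ^ 2 * rho ^ S k) + sigma ^ S k / t - 2 * (x k * r ^ S k)).
    { pose proof (pow_le rho (S k) ltac:(lra)) as HA.
      pose proof (pow_le sigma (S k) ltac:(lra)) as HB.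
      set (A := rho ^ S k) in *; set (B := sigma ^ S k) in *; set (y := r ^ S k) in *.
      specialize (Hx k).
      assert (Hu : 2 * (t * x k) * y <= (t * x k) ^ 2 * A + B).
      (* Comparing squares avoids square roots of [A] and [B]: since [y^2 = A B], the gap is the
         square of [(t x)^2 A - B]. *)
      { apply Rsqr_incr_0_var; [unfold Rsqr | pose proof (pow2_ge_0 (t * x k)); nra].
        pose proof (pow2_ge_0 ((t * x k) ^ 2 * A - B)).
        replace (2 * (t * x k) * y * (2 * (t * x k) * y))
          with (4 * (t * x k) ^ 2 * y ^ 2) by ring.
        rewrite Hpow; nra. }
      replace (t * (x k ^ 2 * A) + B / t - 2 * (x k * y))
        with (((t * x k) ^ 2 * A + B - 2 * (t * x k) * y) / t) by (field; lra).
      apply Rdiv_le_0_compat; lra. }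
    replace (t * rho / 2 * (rho ^ k * x k ^ 2) + sigma / t / 2 * sigma ^ k)
      with ((t * (x k ^ 2 * rho ^ S k) + sigma ^ S k / t) / 2) by (simpl; field; lra).
    lra.
  - rewrite sum_n_plus, !(@sum_n_mult_l R_Ring).
    change (@plus R_AbelianMonoid) with Rplus; change (@mult R_Ring) with Rmult.
    assert (Hqr : 0 <= q * rho < 1) by nra.
    assert (H1 : sum_n (fun k => rho ^ k * x k ^ 2) m <= (1 - q) ^ 2 * / (1 - q * rho)).
    { eapply Rle_trans.
      - apply (weighted_sum_le (fun k => x k ^ 2) (fun k => (1 - q) ^ 2 * q ^ k)); [exact Hmaj|].
        intros k; pose proof (pow_le rho k ltac:(lra)); simpl; nra.
      - rewrite (sum_n_ext _ (fun k => @mult R_Ring ((1 - q) ^ 2) ((q * rho) ^ k))).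
        + rewrite (@sum_n_mult_l R_Ring).
          apply Rmult_le_compat_l; [apply pow2_ge_0 | now apply sum_n_geom_le].
        + intros k; change (@mult R_Ring) with Rmult; rewrite Rpow_mult_distr.
          ring_in R. }
    pose proof (sum_n_geom_le sigma m Hsigma) as H2.
    apply Rle_trans with (t * rho / 2 * ((1 - q) ^ 2 * / (1 - q * rho))
                          + sigma / t / 2 * / (1 - sigma)).
    + apply Rplus_le_compat; apply Rmult_le_compat_l; try assumption.
      * nra.
      * apply Rdiv_le_0_compat; [apply Rdiv_le_0_compat|]; lra.
    + right; field; lra.
Qed.

(** * Bounds for the Bohr sum in the two ranges of [|a_0|] *)

Lemma nonneg_series_le (u : nat -> R) (B : R) :
  (forall k, 0 <= u k) -> (forall n, sum_n u n <= B) -> ex_series u /\ Series u <= B.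
Proof.
  intros Hu HB.
  destruct (ex_finite_lim_seq_incr (sum_n u) B) as [l Hl]; [|exact HB|].
  - intros n; rewrite sum_Sn; change (@plus R_AbelianMonoid) with Rplus.
    specialize (Hu (S n)); lra.
  - assert (Hs : is_series u l) by exact Hl.
    split; [now exists l|].
    rewrite (is_series_unique _ _ Hs).
    exact (is_lim_seq_le _ _ l B HB Hl (is_lim_seq_const B)).
Qed.

Lemma bohr_sum_le (a : nat -> C) (r B : R) :
  0 <= r ->
  (forall n, sum_n (fun k => Cmod (a (S k)) * r ^ S k) n <= B) ->
  ex_series (fun n => Cmod (a n) * r ^ n) /\
  Series (fun n => Cmod (a n) * r ^ n) <= Cmod (a 0%nat) + B.
Proof.
  intros Hr HB.
  destruct (nonneg_series_le (fun k => Cmod (a (S k)) * r ^ S k) B) as [Hex Hle];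
    [|exact HB|].
  - intros k; apply Rmult_le_pos; [apply Cmod_ge_0 | now apply pow_le].
  - assert (Hex' : ex_series (fun n => Cmod (a n) * r ^ n))
      by (now apply ex_series_incr_1).
    split; [exact Hex'|].
    rewrite Series_incr_1 by exact Hex'; simpl pow at 1; lra.
Qed.

Lemma sum_n_tail_le_above (f : C -> C) (a : nat -> C) (r : R) (n : nat) :
  class_B f -> power_series_on_disc f a -> 0 <= r <= 1 / 3 -> r <= Cmod (a 0%nat) ->
  sum_n (fun k => Cmod (a (S k)) * r ^ S k) n
  <= r * ((1 - Cmod (a 0%nat) ^ 2) / (1 - Cmod (a 0%nat) * r)).
Proof.
  intros Hf Ha Hr Hra.
  pose proof (Cmod_coef0_le f a Hf Ha) as H1.
  pose proof (fun m => sum_sq_tail_le f a m Hf Ha) as Hmaj.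
  set (b := Cmod (a 0%nat)) in *.
  destruct (Req_dec r 0) as [Hr0|Hr0].
  { rewrite Hr0, Rmult_0_l.
    rewrite (sum_n_ext _ (fun _ => 0)) by (intros k; simpl; ring_in R).
    rewrite sum_n_const; lra. }
  destruct (Rle_lt_or_eq_dec _ _ H1) as [Hb|Hb].
  - eapply Rle_trans.
    (* [rho = r / b <= 1] exactly because [r <= b]; [t = b / (1 - b^2)] makes both AM-GM terms equal
       to [r (1 - b^2) / (1 - b r)]. *)
    + apply (weighted_tail_le (fun k => Cmod (a (S k))) (b ^ 2) (r / b) (r * b)
               (b / (1 - b ^ 2)) r n); try assumption.
      * intros k; apply Cmod_ge_0.
      * nra.
      * split; [apply Rdiv_le_0_compat | apply Rle_div_l]; lra.
      * nra.
      * field; lra.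
      * apply Rdiv_lt_0_compat; nra.
    + right; field; repeat split; nra.
  (* For [b = 1] the majorant is zero, so every coefficient after [a 0] vanishes. *)
  - assert (Hz : forall k, Cmod (a (S k)) = 0).
    { intros k.
      specialize (Hmaj k); rewrite Hb in Hmaj.
      rewrite (sum_n_ext (fun k => (1 - 1 ^ 2) ^ 2 * _) (fun _ => 0)) in Hmaj
        by (intros j; ring_in R).
      rewrite sum_n_const, Rmult_0_r in Hmaj.
      assert (Cmod (a (S k)) ^ 2 <= sum_n (fun k => Cmod (a (S k)) ^ 2) k).
      { destruct k as [|k]; [rewrite sum_O; lra|].
        rewrite sum_Sn; change (@plus R_AbelianMonoid) with Rplus.
        pose proof (sum_n_nonneg_le (fun k => Cmod (a (S k)) ^ 2) 0 k
                      (fun j => pow2_ge_0 _) ltac:(lia)) as H.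
        rewrite sum_O in H; pose proof (pow2_ge_0 (Cmod (a 1%nat))); lra. }
      pose proof (Cmod_ge_0 (a (S k))); nra. }
    rewrite (sum_n_ext _ (fun _ => 0)) by (intros k; rewrite Hz; ring_in R).
    rewrite sum_n_const, Hb; right; field; lra.
Qed.

Lemma sum_n_tail_le_below (f : C -> C) (a : nat -> C) (r : R) (n : nat) :
  class_B f -> power_series_on_disc f a -> r <= 1 / 3 -> Cmod (a 0%nat) < r ->
  sum_n (fun k => Cmod (a (S k)) * r ^ S k) n
  <= r * (sqrt (1 - Cmod (a 0%nat) ^ 2) / sqrt (1 - r ^ 2)).
Proof.
  intros Hf Ha Hr Hra.
  pose proof (fun m => sum_sq_tail_le f a m Hf Ha) as Hmaj.
  pose proof (Cmod_ge_0 (a 0%nat)) as H0.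
  set (b := Cmod (a 0%nat)) in *.
  assert (Hb : 0 < 1 - b ^ 2) by nra.
  assert (Hr2 : 0 < 1 - r ^ 2) by nra.
  pose proof (sqrt_lt_R0 _ Hb) as HA; pose proof (sqrt_lt_R0 _ Hr2) as HB.
  pose proof (pow2_sqrt _ (Rlt_le _ _ Hb)) as EA; pose proof (pow2_sqrt _ (Rlt_le _ _ Hr2)) as EB.
  eapply Rle_trans.
  (* Here [r / b] would exceed 1 or be undefined, so [rho] takes its largest admissible value 1; the
     choice of [t] again equalises the two terms. *)
  - apply (weighted_tail_le (fun k => Cmod (a (S k))) (b ^ 2) 1 (r ^ 2)
             (r / (sqrt (1 - b ^ 2) * sqrt (1 - r ^ 2))) r n); try assumption; try nra.
    + intros k; apply Cmod_ge_0.
    + apply Rdiv_lt_0_compat; nra.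
  - rewrite !Rmult_1_r; right.
    set (A := sqrt (1 - b ^ 2)) in *; set (B := sqrt (1 - r ^ 2)) in *.
    rewrite <- EA, <- EB; field; lra.
Qed.

(** * Optimality through one extremal function *)

(* The disc automorphism [(1 - 2z) / (2 - z)]: for every [r <= 1/3] it turns the
   first inequality into an equality with a strictly positive correction term. *)
Definition extremal_fun (z : C) : C := ((1 - 2 * z) / (2 - z))%C.
(** Geometric expansion of [2 - 3 / (2 - z)]. *)
Definition extremal_coef (n : nat) : C :=
  match n with
  | O => (/ 2)%R
  | S k => (- (3 / 4 * (/ 2) ^ k))%R
  end.

Lemma Cmod_two_sub_ge (z : C) : Cmod z < 1 -> 1 <= Cmod (2 - z).
Proof.
  intros Hz.
  pose proof (Cmod_triangle (2 - z) z) as H.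
  replace (2 - z + z)%C with (RtoC 2) in H by ring.
  rewrite Cmod_R, Rabs_pos_eq in H by lra; lra.
Qed.

Lemma two_sub_neq_0 (z : C) : Cmod z < 1 -> (2 - z)%C <> 0.
Proof. intros Hz E; apply Cmod_two_sub_ge in Hz; rewrite E, Cmod_0 in Hz; lra. Qed.

Lemma extremal_holomorphic : holomorphic_on_disc extremal_fun.
Proof.
  intros z Hz.
  pose proof (two_sub_neq_0 z Hz) as Hz0.
  exists ((-3)%R / (2 - z) ^ 2)%C.
  split; [apply is_linear_scal_l|].
  intros x Hx eps.
  apply (@is_filter_lim_locally_unique _ (AbsRing_NormedModule C_AbsRing)) in Hx; subst x.
  (* The first bound keeps [y] in the disc. The second controls the exact remainder
     [-3 (y-z)^2 / ((2-y) (2-z)^2)], of modulus at most [3 |y-z|^2]. *)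
  assert (Hd : 0 < Rmin (1 - Cmod z) (eps / 3)).
  { pose proof (cond_pos eps); apply Rmin_glb_lt; lra. }
  exists (mkposreal _ Hd).
  cut (forall y : C, Cmod (y - z) < Rmin (1 - Cmod z) (eps / 3) ->
         Cmod (extremal_fun y - extremal_fun z - (y - z) * ((-3)%R / (2 - z) ^ 2))
         <= eps * Cmod (y - z)); [intros K y; apply K | intros y Hy].
  assert (Hy1 : Cmod (y - z) < 1 - Cmod z) by (eapply Rlt_le_trans; [exact Hy | apply Rmin_l]).
  assert (Hy2 : Cmod (y - z) < eps / 3) by (eapply Rlt_le_trans; [exact Hy | apply Rmin_r]).
  assert (Hy3 : Cmod y < 1).
  { pose proof (Cmod_triangle (y - z) z) as H.
    replace (y - z + z)%C with y in H by ring; lra. }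
  pose proof (two_sub_neq_0 y Hy3) as Hy0.
  replace (extremal_fun y - extremal_fun z - (y - z) * ((-3)%R / (2 - z) ^ 2))%C
    with ((y - z) * (y - z) * ((-3)%R / ((2 - y) * (2 - z) ^ 2)))%C
    by (unfold extremal_fun; field; split; assumption).
  rewrite !Cmod_mult, Cmod_div, Cmod_mult, Cmod_pow, Cmod_R, Rabs_left
    by (try (apply Cmult_neq_0; [|apply Cpow_nz]); assumption || lra).
  pose proof (Cmod_two_sub_ge y Hy3) as Ky; pose proof (Cmod_two_sub_ge z Hz) as Kz.
  pose proof (Cmod_ge_0 (y - z)) as H0.
  assert (Hden : 1 <= Cmod (2 - y) * Cmod (2 - z) ^ 2) by (simpl; nra).
  assert (Hq : - -3 / (Cmod (2 - y) * Cmod (2 - z) ^ 2) <= 3)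
    by (apply Rle_div_l; lra).
  apply Rle_trans with (Cmod (y - z) * Cmod (y - z) * 3); [|nra].
  apply Rmult_le_compat_l; [nra | exact Hq].
Qed.

Lemma extremal_power_series : power_series_on_disc extremal_fun extremal_coef.
Proof.
  intros z Hz.
  pose proof (two_sub_neq_0 z Hz) as Hz0.
  assert (H2 : RtoC 2 <> 0) by (intros E; apply RtoC_inj in E; lra).
  (* The closed form isolates an explicit remainder, of modulus at most [(3/2) (1/2)^n] on the
     disc. *)
  assert (Hsum : forall n, sum_n (fun k => @scal C_AbsRing C_NormedModule
                (@pow_n C_AbsRing z k) (extremal_coef k)) n
              = (extremal_fun z + (3 / 2)%R * z * (/ 2 * z) ^ n / (2 - z))%C).
  { induction n as [|n IH].
    - rewrite sum_O.
      change (1 * (/ 2)%R = extremal_fun z + (3 / 2)%R * z * 1 / (2 - z))%C.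
      unfold extremal_fun; rewrite RtoC_div, RtoC_inv by lra; field; auto.
    - rewrite sum_Sn, IH.
      change (extremal_fun z + (3 / 2)%R * z * (/ 2 * z) ^ n / (2 - z)
              + z ^ S n * (- (3 / 4 * (/ 2) ^ n))%R
              = extremal_fun z + (3 / 2)%R * z * (/ 2 * z) ^ S n / (2 - z))%C.
      replace (3 / 4) with (3 / 2 * / 2) by lra.
      rewrite RtoC_opp, !RtoC_mult, RtoC_pow, RtoC_inv, !Cpow_S, !Cpow_mult_l by lra.
      field; auto. }
  apply (proj2 (filterlim_locally_ball_norm _ _)); intros eps.
  pose proof (cond_pos eps) as Heps.
  destruct (pow_lt_1_zero (/ 2) ltac:(rewrite Rabs_pos_eq; lra) (eps / 2) ltac:(lra)) as [N HN].
  exists N; intros n Hn; specialize (HN n Hn).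
  unfold ball_norm; rewrite Hsum.
  change (Cmod (extremal_fun z + (3 / 2)%R * z * (/ 2 * z) ^ n / (2 - z) - extremal_fun z)
          < eps).
  replace (extremal_fun z + (3 / 2)%R * z * (/ 2 * z) ^ n / (2 - z) - extremal_fun z)%C
    with ((3 / 2)%R * z * (/ 2 * z) ^ n / (2 - z))%C by ring.
  rewrite Cmod_div, !Cmod_mult, Cmod_pow, Cmod_R, (Rabs_pos_eq (3 / 2)) by (assumption || lra).
  pose proof (Cmod_two_sub_ge z Hz) as Kz; pose proof (Cmod_ge_0 z) as H0.
  apply Rlt_div_l; [lra|].
  assert (Hhalf : Cmod (/ 2 * z) = / 2 * Cmod z).
  { rewrite Cmod_mult, Cmod_inv, Cmod_R, Rabs_pos_eq by (assumption || lra); reflexivity. }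
  assert (Hz2 : Cmod (/ 2 * z) ^ n < eps / 2).
  { eapply Rle_lt_trans; [|exact HN].
    rewrite Rabs_pos_eq by (apply pow_le; lra).
    apply pow_incr; split; [apply Cmod_ge_0 | lra]. }
  assert (0 <= Cmod (/ 2 * z) ^ n) by (apply pow_le, Cmod_ge_0).
  assert (3 / 2 * Cmod z * Cmod (/ 2 * z) ^ n <= 3 / 2 * Cmod (/ 2 * z) ^ n) by nra.
  nra.
Qed.

(** The bound rests on [|2 - z|^2 - |1 - 2z|^2 = 3 (1 - |z|^2)]. *)
Lemma extremal_class_B : class_B extremal_fun.
Proof.
  split; [exact extremal_holomorphic|].
  intros z Hz; unfold extremal_fun.
  pose proof (two_sub_neq_0 z Hz) as Hz0.
  pose proof (Cmod_two_sub_ge z Hz) as Kz; pose proof (Cmod_ge_0 z) as H0.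
  rewrite Cmod_div by assumption.
  apply Rle_div_l; [lra|]; rewrite Rmult_1_l.
  apply Rsqr_incr_0_var; [|lra].
  rewrite !Rsqr_pow2, !Cmod2_alt.
  assert (Hz2 : Cmod z ^ 2 <= 1) by nra.
  rewrite Cmod2_alt in Hz2.
  destruct z as [x y]; simpl in *; nra.
Qed.

Lemma extremal_series (r : R) : 0 <= r <= 1 / 3 ->
  Series (fun n => Cmod (extremal_coef n) * r ^ n) = 1 / 2 + 3 / 4 * r / (1 - r / 2).
Proof.
  intros Hr.
  apply is_series_unique, is_series_decr_1.
  apply (is_series_ext (fun k => @scal R_AbsRing R_NormedModule (3 / 4 * r) ((r / 2) ^ k))).
  - intros k.
    change (3 / 4 * r * (r / 2) ^ k = Cmod (- (3 / 4 * (/ 2) ^ k))%R * r ^ S k).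
    pose proof (pow_le (/ 2) k ltac:(lra)).
    rewrite Cmod_R, Rabs_Ropp, Rabs_pos_eq by lra.
    unfold Rdiv at 2; rewrite Rpow_mult_distr; simpl; ring.
  - replace (plus _ _) with (@scal R_AbsRing R_NormedModule (3 / 4 * r) (/ (1 - r / 2))).
    + apply is_series_scal, is_series_geom; rewrite Rabs_pos_eq; lra.
    + change (3 / 4 * r * / (1 - r / 2)
              = 1 / 2 + 3 / 4 * r / (1 - r / 2) + - (Cmod (/ 2)%R * 1)).
      rewrite Cmod_R, Rabs_pos_eq by lra; field; lra.
Qed.

Lemma extremal_psi (r : R) : 0 <= r <= 1 / 3 ->
  psi extremal_fun r = 1 / 2 - 3 / 4 * r / (1 - r / 2).
Proof.
  intros Hr; unfold psi, Psi, extremal_fun.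
  replace ((1 - 2 * 0) / (2 - 0))%C with (RtoC (/ 2)).
  2:{ rewrite RtoC_inv by lra; field; intros E; apply RtoC_inj in E; lra. }
  rewrite Cmod_R, Rabs_pos_eq by lra.
  destruct (Rle_dec r (/ 2)) as [H|H]; [|lra].
  field; lra.
Qed.

Theorem theorem3p5 :
  (forall (f : C -> C) (a : nat -> C) (r : R),
      class_B f -> power_series_on_disc f a -> 0 <= r <= 1 / 3 ->
      ex_series (fun n : nat => Cmod (a n) * r ^ n) /\
      (r <= Cmod (a 0%nat) <= 1 ->
       Series (fun n : nat => Cmod (a n) * r ^ n)
       + (1 - Cmod (a 0%nat)
          - r * ((1 - Cmod (a 0%nat) ^ 2) / (1 - Cmod (a 0%nat) * r))) <= 1) /\
      (0 <= Cmod (a 0%nat) < r ->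
       Series (fun n : nat => Cmod (a n) * r ^ n)
       + (1 - Cmod (a 0%nat)
          - r * (sqrt (1 - Cmod (a 0%nat) ^ 2) / sqrt (1 - r ^ 2))) <= 1)) /\
  (forall r : R, 0 <= r <= 1 / 3 ->
      ~ exists lambda : R, 1 < lambda /\
          forall (f : C -> C) (a : nat -> C),
            class_B f -> power_series_on_disc f a ->
            Series (fun n : nat => Cmod (a n) * r ^ n) + lambda * psi f r <= 1).
Proof.
  split.
  - intros f a r Hf Ha Hr.
    destruct (Rle_lt_dec r (Cmod (a 0%nat))) as [Hra|Hra].
    + destruct (bohr_sum_le a r _ ltac:(lra)
                  (fun n => sum_n_tail_le_above f a r n Hf Ha Hr Hra)) as [Hex Hle].
      split; [exact Hex | split; intros H; lra].
    + destruct (bohr_sum_le a r _ ltac:(lra)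
                  (fun n => sum_n_tail_le_below f a r n Hf Ha (proj2 Hr) Hra)) as [Hex Hle].
      split; [exact Hex | split; intros H; lra].
  - intros r Hr [lambda [Hl H]].
    specialize (H _ _ extremal_class_B extremal_power_series).
    rewrite extremal_series, extremal_psi in H by exact Hr.
    (* This says that [psi extremal_fun r > 0]. The Bohr sum and [psi] add up to 1, so the left side
       of [H] exceeds 1 by [(lambda - 1) psi]. *)
    assert (3 / 4 * r / (1 - r / 2) < 1 / 2) by (apply Rlt_div_l; lra).
    nra.
Qed.
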